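(* Let $\lambda>0$ and let $\phi$ be a smooth nonnegative function with $\int_{\mathbb{R}}\phi(y^2)\,dy=1$. Consider the ansatz $$f(t,x,v)=m(t)\,\phi\big(a(t)\,(v-b(t)x)^2\big),\qquad (x,v)\in\mathbb{R}\times\mathbb{R},$$ with $m(t)>0$, $a(t)>0$ and $b(t)\in\mathbb{R}$. Its density and bulk velocity are $\rho_f(t,x)=\rho(t):=m(t)/\sqrt{a(t)}$ (independent of $x$, so that $f$ has infinite total mass) and $u_f(t,x)=b(t)x$. The function $f$ solves the granular kinetic equation with $\gamma=2$, $$\partial_t f+v\,\partial_x f=\frac{\lambda}{2}\,\rho_f\,\partial_v\big((v-u_f)f\big),$$ as long as $(m,a,b)$ solves $$m'=\frac{\lambda m^2}{2\sqrt a},\qquad a'=2ab+\lambda m\sqrt a,\qquad b'=-b^2,$$ equivalently, in terms of $(\rho,m,b)$ with $\rho=m/\sqrt a$, $$\rho'=-b\rho,\qquad m'=\frac{\lambda}{2}\rho m,\qquad b'=-b^2.$$ For initial data $(\rho,m,b)(0)=(\rho_0,m_0,b_0)$ with $\rho_0>0$, $m_0>0$, $b_0<0$, set $T=\frac{1}{-b_0}>0$. Then the solution of this ODE system is, for $t\in[0,T)$, $$b(t)=-\frac{1}{T-t},\qquad \rho(t)=\frac{\rho_0T}{T-t},\qquad m(t)=m_0\Big(\frac{T}{T-t}\Big)^{\frac{\lambda}{2}\rho_0T},$$ which always blows up at the finite time $T$ (in particular $b(t)\to-\infty$ as $t\to T^-$). The typical width of the velocity support of $f$ is $$\frac{1}{\sqrt{a(t)}}=\frac{\rho(t)}{m(t)}=\frac{\rho_0}{m_0}\Big(\frac{T}{T-t}\Big)^{1-\frac{\lambda}{2}\rho_0T}.$$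 Hence, with $\epsilon=T-t$ and $\sim$ denoting equality up to a constant multiple, as $t\to T^-$, $$b\sim-\epsilon^{-1},\qquad \rho\sim\epsilon^{-1},\qquad m\sim\epsilon^{-\frac{\lambda}{2}\rho_0T},\qquad \frac{1}{\sqrt a}\sim\epsilon^{\frac{\lambda}{2}\rho_0T-1}.$$ Consequently, as $t\to T^-$, $\frac{1}{\sqrt{a(t)}}\to0$ if $\lambda\rho_0T>2$, and $\frac{1}{\sqrt{a(t)}}\to\infty$ if $\lambda\rho_0T<2$.
   Context: For a nonnegative function $f(t,x,v)$ with $t\ge 0$, $x,v\in\mathbb{R}$, the density $\rho_f$ and bulk velocity $u_f$ are defined by $$\rho_f(t,x)=\int_{\mathbb{R}}f(t,x,v)\,dv,\qquad \rho_f(t,x)\,u_f(t,x)=\int_{\mathbb{R}}v\,f(t,x,v)\,dv.$$ The equation in the claim is the granular kinetic equation $\partial_t f+v\,\partial_x f=\frac{\lambda}{2}\partial_v\big((\partial_vW*_vf)f\big)$ with interaction kernel $W(v)=|v|^\gamma/\gamma$ in the case $\gamma=2$, rewritten using $\rho_f$ and $u_f$; here $*_v$ is convolution in $v$, and $\lambda$ is the strength of inelasticity. Primes denote derivatives in $t$.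
   Formalization: The claims involving the bulk velocity (u_f = b(t)x, the velocity profile centred at u_f, and the kinetic equation) are stated when the integral of v f over v converges; unit mass alone does not ensure this, e.g. φ(s) = 1/(π(1+s)) for s ≥ 0, where u_f is undefined. *)

(* Defs.v *)
From Stdlib Require Import Reals.
From Coquelicot Require Import Coquelicot.

Open Scope R_scope.

(** Integrals over the whole line are improper Riemann integrals, the two
    endpoints going to infinity independently.  For a continuous nonnegative
    [g] this is the Lebesgue integral, and since [v * g v] has constant sign
    on each half-line, convergence of its integral is absolute convergence. *)
Definition is_RInt_line (g : R -> R) (l : R) : Prop :=
  is_RInt_gen g (Rbar_locally m_infty) (Rbar_locally p_infty) l.

Definition ex_RInt_line (g : R -> R) : Prop :=
  ex_RInt_gen g (Rbar_locally m_infty) (Rbar_locally p_infty).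

Definition RInt_line (g : R -> R) : R :=
  RInt_gen g (Rbar_locally m_infty) (Rbar_locally p_infty).

Definition smooth (g : R -> R) : Prop := forall n x, ex_derive_n g n x.

(** The time interval [[0, S)], where [S] may be [p_infty]. *)
Definition in_time (S : Rbar) (t : R) : Prop := 0 <= t /\ Rbar_lt (Finite t) S.

(** Derivative relative to a set of times: [is_derive] with [locally t] cut
    down to [D], hence the right derivative at the left endpoint [0] of
    [in_time S], and the usual derivative at interior points. *)
Definition is_derive_on (D : R -> Prop) (g : R -> R) (t l : R) : Prop :=
  filterdiff g (within D (locally t)) (fun h => scal h l).

(** Kinetic functions are written [f t x v]. *)
Definition density (f : R -> R -> R -> R) (t x : R) : R :=
  RInt_line (fun v => f t x v).

Definition bulk_velocity (f : R -> R -> R -> R) (t x : R) : R :=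
  RInt_line (fun v => v * f t x v) / density f t x.

Definition ex_density (f : R -> R -> R -> R) (t x : R) : Prop :=
  ex_RInt_line (fun v => f t x v).

Definition ex_momentum (f : R -> R -> R -> R) (t x : R) : Prop :=
  ex_RInt_line (fun v => v * f t x v).

(** Classical solutions on [[0, S)] of
    [d_t f + v d_x f = (lambda / 2) rho_f d_v ((v - u_f) f)]; the integrals
    defining [rho_f] and [u_f] are required to converge. *)
Definition solves_granular (lambda : R) (S : Rbar) (f : R -> R -> R -> R)
  : Prop :=
  forall t x, in_time S t ->
    ex_density f t x /\ ex_momentum f t x /\
    forall v, exists ft fx q : R,
      is_derive_on (in_time S) (fun s => f s x v) t ft /\
      is_derive (fun y => f t y v) x fx /\
      is_derive (fun w => (w - bulk_velocity f t x) * f t x w) v q /\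
      ft + v * fx = lambda / 2 * density f t x * q.

Definition ansatz (phi m a b : R -> R) (t x v : R) : R :=
  m t * phi (a t * (v - b t * x) ^ 2).

(** [w] is the velocity width of [f t x] relative to the profile
    [y |-> phi (y ^ 2)] of unit mass: [f t x] is that profile, centered at the
    bulk velocity, stretched by [w] and normalized to the density of [f].  In
    particular the velocity support of [f t x] is [u_f + w * K], with [K] the
    support of the profile. *)
Definition velocity_width (phi : R -> R) (f : R -> R -> R -> R) (t x w : R)
  : Prop :=
  0 < w /\
  forall y, f t x (bulk_velocity f t x + w * y)
            = density f t x / w * phi (y ^ 2).

Definition ode_mab (lambda : R) (S : Rbar) (m a b : R -> R) : Prop :=
  forall t, in_time S t ->
    is_derive_on (in_time S) m t (lambda * m t ^ 2 / (2 * sqrt (a t))) /\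
    is_derive_on (in_time S) a t
      (2 * a t * b t + lambda * m t * sqrt (a t)) /\
    is_derive_on (in_time S) b t (- b t ^ 2).

Definition ode_rmb (lambda : R) (S : Rbar) (rho m b : R -> R) : Prop :=
  forall t, in_time S t ->
    is_derive_on (in_time S) rho t (- b t * rho t) /\
    is_derive_on (in_time S) m t (lambda / 2 * rho t * m t) /\
    is_derive_on (in_time S) b t (- b t ^ 2).

(** Equality up to a positive constant multiple, as [t -> T^-]. *)
Definition sim_left (T : R) (g h : R -> R) : Prop :=
  exists C : R, 0 < C /\ at_left T (fun t => g t = C * h t).

(* Main.v *)
(** The part on the kinetic equation is the substitution [y = sqrt a * (v - b x)]
    in the integrals, the oddness of [w * phi (a w ^ 2)] for the momentum, and
    the chain rule.  For the blow-up, [1 + b (T - t)] solves the linear equation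
    [c' = - b c] with [c 0 = 0], so it vanishes on the whole lifespan: this gives
    [b], and bounds the lifespan by [T], since the identity fails at [t = T].
    Then [rho] and [m] follow from conserved quantities. *)

Require Import Defs.
From Stdlib Require Import Reals Lra.
From Coquelicot Require Import Coquelicot.

Open Scope R_scope.

(** * Calculus on a time interval with one-sided derivatives at [0] *)

Lemma in_time_dec (S : Rbar) (t : R) : {in_time S t} + {~ in_time S t}.
Proof.
  unfold in_time.
  destruct (Rle_dec 0 t); [|right; tauto].
  destruct (Rbar_lt_dec t S); [left|right]; tauto.
Qed.

Lemma in_time_le (S : Rbar) (s t : R) : 0 <= s <= t -> in_time S t -> in_time S s.
Proof.
  intros [Hs Hst] [_ Ht]; split; [exact Hs|].
  now apply Rbar_le_lt_trans with (Finite t).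
Qed.

Lemma locally_lt_Rbar (S : Rbar) (t : R) :
  Rbar_lt t S -> locally t (fun y => Rbar_lt (Finite y) S).
Proof.
  intros Ht; destruct S as [S| |]; simpl in *; [|now apply filter_true|easy].
  now apply open_lt.
Qed.

Lemma locally_in_time (S : Rbar) (t : R) :
  0 < t -> in_time S t -> locally t (in_time S).
Proof.
  intros H0 [_ Ht].
  apply filter_imp with (fun y => 0 < y /\ Rbar_lt (Finite y) S).
  - intros y [Hy HS]; split; [lra|exact HS].
  - apply filter_and; [now apply open_gt|now apply locally_lt_Rbar].
Qed.

(** Extending [g] by its tangent line outside [in_time S] turns one-sided
    derivatives into two-sided ones, to which ordinary calculus applies. *)
Lemma is_derive_on_iff_ext (S : Rbar) (g : R -> R) (t l : R) :
  in_time S t ->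
  (is_derive_on (in_time S) g t l <->
   exists G : R -> R, (forall y, in_time S y -> G y = g y) /\ is_derive G t l).
Proof.
  intros Dt; split.
  - intros [Hl Hg].
    exists (fun y => if in_time_dec S y then g y else g t + (y - t) * l).
    split; [intros y Dy; destruct (in_time_dec S y); tauto|].
    split; [apply is_linear_scal_l|].
    intros x Hx.
    apply (is_filter_lim_locally_unique t x) in Hx; subst x.
    intros eps.
    assert (Hlim : is_filter_lim (within (in_time S) (locally t)) t).
    { intros P; apply (filter_imp (F := locally t)); intros y HP _; exact HP. }
    generalize (Hg t Hlim eps); apply (filter_imp (F := locally t)); intros y Hy.
    destruct (in_time_dec S t) as [_|]; [|tauto].
    destruct (in_time_dec S y) as [Dy|_]; [now apply Hy|].
    (* Outside [in_time S] the extension is the tangent line itself, so the error term vanishes. *)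
    replace (minus _ (scal _ _)) with (zero : R_NormedModule).
    + rewrite (@norm_zero R_AbsRing R_NormedModule).
      apply Rmult_le_pos; [apply Rlt_le, cond_pos|apply norm_ge_0].
    + unfold minus, plus, opp, scal, zero; simpl; unfold mult; simpl; ring.
  - intros [G [HG [Hl HdG]]]; split; [exact Hl|].
    intros x Hx.
    (* [t] belongs to the time set, so a limit [x <> t] of the restricted filter would put [t]
       itself in the set of points different from [t]. *)
    assert (Hxt : x = t).
    { destruct (Req_dec x t) as [|Hne]; [assumption|exfalso].
      assert (Hn : locally x (fun y => y <> t)) by now apply open_neq.
      apply Hx, locally_singleton in Hn; now apply Hn. }
    subst x; intros eps.
    generalize (HdG t (fun P H => H) eps); apply (filter_imp (F := locally t)); intros y Hy Dy.
    now rewrite <- !HG.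
Qed.

Lemma is_derive_on_of_is_derive (S : Rbar) (g : R -> R) (t l : R) :
  in_time S t -> is_derive g t l -> is_derive_on (in_time S) g t l.
Proof.
  intros Dt Hg; apply is_derive_on_iff_ext; [exact Dt|now exists g].
Qed.

Lemma is_derive_of_is_derive_on (S : Rbar) (g : R -> R) (t l : R) :
  0 < t -> in_time S t -> is_derive_on (in_time S) g t l -> is_derive g t l.
Proof.
  intros Ht Dt [G [HG HdG]]%is_derive_on_iff_ext; [|exact Dt].
  apply is_derive_ext_loc with G; [|exact HdG].
  generalize (locally_in_time S t Ht Dt); now apply filter_imp.
Qed.

(** Freezing [g] to the left of [0] makes it two-sidedly continuous at [0]. *)
Lemma continuity_pt_Rmax_is_derive_on (S : Rbar) (g : R -> R) (t l : R) :
  in_time S t -> is_derive_on (in_time S) g t l ->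
  continuity_pt (fun y => g (Rmax 0 y)) t.
Proof.
  intros Dt [G [HG HdG]]%is_derive_on_iff_ext; [|exact Dt].
  assert (Hmax : Rmax 0 t = t) by (apply Rmax_right, Dt).
  apply continuity_pt_filterlim.
  apply filterlim_ext_loc with (fun y => G (Rmax 0 y)).
  (* Near [t], points stay below [S], and negative ones are sent to [0 <= t]; so [Rmax 0 y] lies in
     [in_time S], where [G] and [g] agree. *)
  - destruct Dt as [H0 HS]; generalize (locally_lt_Rbar S t HS); apply filter_imp.
    intros y Hy; apply HG; split; [apply Rmax_l|].
    unfold Rmax; destruct (Rle_dec 0 y); [exact Hy|].
    apply Rbar_le_lt_trans with (Finite t); [exact H0|exact HS].
  - rewrite Hmax, <- (HG t Dt).
    replace (G t) with (G (Rmax 0 t)) by now rewrite Hmax.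
    apply (continuous_comp (fun y => Rmax 0 y) G).
    (* Continuity of [Rmax 0] is read off from [max(0, y) = (y + |y|) / 2]. *)
    + apply (continuous_ext (fun y => (y + Rabs y) / 2)).
      { intros y; unfold Rmax, Rabs; destruct (Rle_dec 0 y), (Rcase_abs y); simpl; lra. }
      apply (continuous_scal_l (fun y => y + Rabs y) (/ 2)).
      apply (continuous_plus (fun y => y) Rabs); [apply continuous_id|apply continuous_Rabs].
    + rewrite Hmax; apply (ex_derive_continuous G); now exists l.
Qed.

(** [MVT_gen] asks for derivatives at interior points only, but for two-sided continuity at both
    ends; composing with [Rmax 0] provides it at [0] and changes nothing on [[0, t]]. *)
Lemma MVT_in_time (S : Rbar) (g g' : R -> R) (t : R) :
  in_time S t ->
  (forall s, in_time S s -> is_derive_on (in_time S) g s (g' s)) ->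
  exists c, in_time S c /\ g t - g 0 = g' c * t.
Proof.
  intros Dt Hg; assert (H0 := proj1 Dt).
  destruct (MVT_gen (fun y => g (Rmax 0 y)) 0 t g') as [c [Hc E]].
  - rewrite Rmin_left, Rmax_right by exact H0; intros s Hs.
    assert (Ds : in_time S s) by (apply in_time_le with t; [lra|exact Dt]).
    apply is_derive_ext_loc with g.
    + assert (Hs0 : locally s (fun y => 0 < y)) by (apply open_gt; lra).
      revert Hs0; apply filter_imp; intros y Hy; now rewrite Rmax_right by lra.
    + apply is_derive_of_is_derive_on with S; [lra|exact Ds|now apply Hg].
  - rewrite Rmin_left, Rmax_right by exact H0; intros s Hs.
    assert (Ds : in_time S s) by (apply in_time_le with t; [lra|exact Dt]).
    apply continuity_pt_Rmax_is_derive_on with S (g' s); [exact Ds|now apply Hg].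
  - rewrite Rmin_left, Rmax_right in Hc by exact H0.
    exists c; split; [apply in_time_le with t; [lra|exact Dt]|].
    rewrite Rmax_right, Rmax_left in E by lra.
    rewrite E; ring.
Qed.

Lemma is_derive_on_0_const (S : Rbar) (g : R -> R) (t : R) :
  (forall s, in_time S s -> is_derive_on (in_time S) g s 0) ->
  in_time S t -> g t = g 0.
Proof.
  intros Hg Dt.
  destruct (MVT_in_time S g (fun _ => 0) t Dt Hg) as [c [_ E]]; lra.
Qed.

(** Gronwall: with [k <= M] on [[0, t]], [c ^ 2 * exp (- 2 * M * s)] is
    nonnegative, nonincreasing and vanishes at [0]. *)
Lemma linear_ode_zero (S : Rbar) (c k k' : R -> R) (t : R) :
  (forall s, in_time S s -> is_derive_on (in_time S) k s (k' s)) ->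
  (forall s, in_time S s -> is_derive_on (in_time S) c s (k s * c s)) ->
  c 0 = 0 -> in_time S t -> c t = 0.
Proof.
  intros Hk Hc H0 Dt; assert (Ht := proj1 Dt).
  destruct Ht as [Ht|<-]; [|exact H0].
  (* [k] is differentiable, hence continuous on [[0, t]], and its maximum there serves as [M]. *)
  destruct (continuity_ab_maj (fun y => k (Rmax 0 y)) 0 t) as [x [HM _]]; [lra| |].
  { intros s Hs; apply continuity_pt_Rmax_is_derive_on with S (k' s).
    - now apply in_time_le with t.
    - now apply Hk, in_time_le with t. }
  set (M := k (Rmax 0 x)) in HM.
  destruct (MVT_gen (fun s => (c (Rmax 0 s)) ^ 2 * exp (- 2 * M * s)) 0 t
    (fun s => 2 * (c (Rmax 0 s)) ^ 2 * (k (Rmax 0 s) - M) * exp (- 2 * M * s)))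
    as [s [Hs E]].
  - rewrite Rmin_left, Rmax_right by lra; intros s Hs.
    assert (Ds : in_time S s) by (apply in_time_le with t; [lra|exact Dt]).
    assert (Hcs := is_derive_of_is_derive_on S c s _ (proj1 Hs) Ds (Hc s Ds)).
    apply is_derive_ext_loc with (fun s => c s ^ 2 * exp (- 2 * M * s)).
    + assert (Hs0 : locally s (fun y => 0 < y)) by (apply open_gt; lra).
      revert Hs0; apply filter_imp; intros y Hy; now rewrite Rmax_right by lra.
    + auto_derive; [eexists; exact Hcs|].
      replace (Derive (fun x0 : R => c x0) s) with (k s * c s)
        by (symmetry; now apply is_derive_unique).
      rewrite Rmax_right by lra; ring.
  - rewrite Rmin_left, Rmax_right by lra; intros s Hs.
    assert (Ds : in_time S s) by (apply in_time_le with t; [lra|exact Dt]).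
    assert (Hcs := continuity_pt_Rmax_is_derive_on S c s _ Ds (Hc s Ds)).
    apply continuity_pt_mult.
    + apply (continuity_pt_comp (fun y => c (Rmax 0 y)) (fun y => y ^ 2)); [exact Hcs|].
      apply derivable_continuous_pt, derivable_pt_pow.
    + apply continuity_pt_filterlim.
      apply (ex_derive_continuous (fun s => exp (- 2 * M * s))).
      auto_derive; exact I.
  - rewrite Rmin_left, Rmax_right in Hs by lra.
    rewrite (Rmax_right 0 t), (Rmax_left 0 0), H0 in E by lra.
    specialize (HM s Hs); simpl in HM.
    assert (He : 0 < exp (- 2 * M * t)) by apply exp_pos.
    assert (He' : 0 < exp (- 2 * M * s)) by apply exp_pos.
    assert (Hle : c t ^ 2 * exp (- 2 * M * t) <= 0).
    { replace (c t ^ 2 * exp (- 2 * M * t)) with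
        (- (2 * t * c (Rmax 0 s) ^ 2 * exp (- 2 * M * s) * (M - k (Rmax 0 s)))) by lra.
      assert (0 <= 2 * t * c (Rmax 0 s) ^ 2 * exp (- 2 * M * s) * (M - k (Rmax 0 s))).
      { assert (Hc2 := pow2_ge_0 (c (Rmax 0 s))).
        apply Rmult_le_pos; [|lra].
        apply Rmult_le_pos; [|lra].
        apply Rmult_le_pos; [lra|exact Hc2]. }
      lra. }
    destruct (Req_dec (c t) 0) as [|Hne]; [assumption|exfalso].
    assert (0 < c t ^ 2) by (apply pow2_gt_0; exact Hne).
    assert (0 < c t ^ 2 * exp (- 2 * M * t)) by now apply Rmult_lt_0_compat.
    lra.
Qed.

(** * Improper integrals over the line: substitutions and symmetry *)

Lemma is_RInt_line_unique (g : R -> R) (l : R) : is_RInt_line g l -> RInt_line g = l.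
Proof. exact (is_RInt_gen_unique (V := R_CompleteNormedModule) g l). Qed.

Lemma RInt_line_correct (g : R -> R) : ex_RInt_line g -> is_RInt_line g (RInt_line g).
Proof. exact (RInt_gen_correct (V := R_CompleteNormedModule) g). Qed.

Lemma is_RInt_line_ext (g h : R -> R) (l : R) :
  (forall y, g y = h y) -> is_RInt_line g l -> is_RInt_line h l.
Proof.
  intros E; apply is_RInt_gen_ext; apply filter_forall; intros I y _; apply E.
Qed.

Lemma is_RInt_line_scal (g : R -> R) (k l : R) :
  is_RInt_line g l -> is_RInt_line (fun v => k * g v) (k * l).
Proof. exact (is_RInt_gen_scal g k l). Qed.

(** For [k > 0] the map [v |-> k * v + c] pulls neighborhoods of each infinite end back to
    neighborhoods of the same end, so the substitution on bounded intervals passes to the limit. *)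
Lemma is_RInt_line_comp_lin (g : R -> R) (l k c : R) :
  0 < k -> is_RInt_line g l -> is_RInt_line (fun v => k * g (k * v + c)) l.
Proof.
  intros Hk Hg P HP.
  destruct (Hg P HP) as [Q1 Q2 [M1 H1] [M2 H2] H].
  apply Filter_prod with (fun A => Q1 (k * A + c)) (fun B => Q2 (k * B + c)).
  - exists ((M1 - c) / k); intros A HA; apply H1.
    apply (Rmult_lt_compat_l k) in HA; [|exact Hk].
    replace (k * ((M1 - c) / k)) with (M1 - c) in HA by (field; lra); lra.
  - exists ((M2 - c) / k); intros B HB; apply H2.
    apply (Rmult_lt_compat_l k) in HB; [|exact Hk].
    replace (k * ((M2 - c) / k)) with (M2 - c) in HB by (field; lra); lra.
  - intros A B HA HB.
    destruct (H _ _ HA HB) as [y [Hy HPy]]; exists y; split; [|exact HPy].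
    exact (is_RInt_comp_lin g k c A B y Hy).
Qed.

(** Reflection exchanges the two ends, hence [Q2] and [Q1] trade places; the sign from swapping the
    bounds cancels the sign from the substitution. *)
Lemma is_RInt_line_comp_opp (g : R -> R) (l : R) :
  is_RInt_line g l -> is_RInt_line (fun v => g (- v)) l.
Proof.
  intros Hg P HP.
  destruct (Hg P HP) as [Q1 Q2 [M1 H1] [M2 H2] H].
  apply Filter_prod with (fun A => Q2 (- A)) (fun B => Q1 (- B)).
  - exists (- M2); intros A HA; apply H2; lra.
  - exists (- M1); intros B HB; apply H1; lra.
  - intros A B HA HB.
    destruct (H _ _ HB HA) as [y [Hy HPy]]; exists y; split; [|exact HPy].
    simpl in *; apply is_RInt_swap, is_RInt_comp_opp, is_RInt_opp in Hy.
    rewrite opp_opp in Hy; revert Hy; apply is_RInt_ext; intros s _; apply opp_opp.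
Qed.

(** The reflected integrand integrates to [l] by substitution and to [- l] by oddness. *)
Lemma is_RInt_line_odd (h : R -> R) (l : R) :
  (forall w, h (- w) = - h w) -> is_RInt_line h l -> l = 0.
Proof.
  intros Hodd Hh.
  assert (H1 := is_RInt_line_unique _ _ (is_RInt_line_comp_opp h l Hh)).
  assert (H2 : is_RInt_line (fun w => h (- w)) (- l)).
  { apply is_RInt_line_ext with (fun w => opp (h w)); [intros w; now rewrite Hodd|].
    now apply (is_RInt_gen_opp h l). }
  apply is_RInt_line_unique in H2; lra.
Qed.

(** * Density, bulk velocity and velocity width of the ansatz *)

Lemma is_RInt_line_ansatz (phi m a b : R -> R) (t x : R) :
  is_RInt_line (fun y => phi (y ^ 2)) 1 -> 0 < a t ->
  is_RInt_line (fun v => ansatz phi m a b t x v) (m t / sqrt (a t)).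
Proof.
  intros Hphi Ha.
  assert (Hs : 0 < sqrt (a t)) by now apply sqrt_lt_R0.
  assert (E : a t = sqrt (a t) * sqrt (a t)) by (symmetry; apply sqrt_sqrt; lra).
  apply (is_RInt_line_comp_lin _ _ (sqrt (a t)) (- (sqrt (a t) * (b t * x))) Hs) in Hphi.
  (* The substitution brings out a factor [sqrt (a t)], which is divided out here. *)
  apply (is_RInt_line_scal _ (m t / sqrt (a t))) in Hphi; rewrite Rmult_1_r in Hphi.
  revert Hphi; apply is_RInt_line_ext; intros v.
  unfold ansatz.
  replace ((sqrt (a t) * v + - (sqrt (a t) * (b t * x))) ^ 2)
    with (sqrt (a t) * sqrt (a t) * (v - b t * x) ^ 2) by ring.
  rewrite <- E; field; lra.
Qed.

Lemma density_ansatz (phi m a b : R -> R) (t x : R) :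
  is_RInt_line (fun y => phi (y ^ 2)) 1 -> 0 < a t ->
  density (ansatz phi m a b) t x = m t / sqrt (a t).
Proof. intros Hphi Ha; now apply is_RInt_line_unique, is_RInt_line_ansatz. Qed.

(** The first moment centered at [b t * x] becomes, after a shift, the integral of an odd function,
    so the momentum is [b t * x] times the density. Convergence of the momentum is what turns
    [RInt_line] into a genuine integral. *)
Lemma bulk_velocity_ansatz (phi m a b : R -> R) (t x : R) :
  is_RInt_line (fun y => phi (y ^ 2)) 1 -> 0 < m t -> 0 < a t ->
  ex_momentum (ansatz phi m a b) t x ->
  bulk_velocity (ansatz phi m a b) t x = b t * x.
Proof.
  intros Hphi Hm Ha Hex.
  assert (Hs : 0 < sqrt (a t)) by now apply sqrt_lt_R0.
  assert (Hd := is_RInt_line_ansatz phi m a b t x Hphi Ha).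
  apply RInt_line_correct in Hex.
  unfold bulk_velocity; rewrite density_ansatz by assumption.
  set (p := RInt_line _) in *; set (d := m t / sqrt (a t)) in *.
  assert (Hd0 : 0 < d) by now apply Rdiv_lt_0_compat.
  (* [H] integrates [(v - b t * x) * f] to [p - b t * x * d]; the next line shifts by
     [v = w + b t * x]. *)
  assert (H := is_RInt_gen_minus _ _ _ _ Hex (is_RInt_gen_scal _ (b t * x) _ Hd)).
  apply (is_RInt_line_comp_lin _ _ 1 (b t * x) Rlt_0_1) in H.
  apply is_RInt_line_odd in H.
  - change (p - b t * x * d = 0) in H.
    replace p with (b t * x * d) by lra; field; lra.
  - intros w; unfold ansatz, minus, plus, opp, scal; simpl; unfold mult; simpl.
    replace (1 * - w + b t * x - b t * x) with (- w) by ring.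
    replace (1 * w + b t * x - b t * x) with w by ring.
    replace (- w * (- w * 1)) with (w * (w * 1)) by ring.
    ring.
Qed.

(** At [v = b x + y / sqrt a] the argument of [phi] is [y ^ 2], and density over width gives back
    [m]. *)
Lemma velocity_width_ansatz (phi m a b : R -> R) (t x : R) :
  is_RInt_line (fun y => phi (y ^ 2)) 1 -> 0 < m t -> 0 < a t ->
  ex_momentum (ansatz phi m a b) t x ->
  velocity_width phi (ansatz phi m a b) t x (1 / sqrt (a t)).
Proof.
  intros Hphi Hm Ha Hex.
  assert (Hs : 0 < sqrt (a t)) by now apply sqrt_lt_R0.
  assert (E : a t = sqrt (a t) * sqrt (a t)) by (symmetry; apply sqrt_sqrt; lra).
  split; [apply Rdiv_lt_0_compat; lra|].
  intros y; rewrite bulk_velocity_ansatz, density_ansatz by assumption.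
  unfold ansatz.
  replace (a t * (b t * x + 1 / sqrt (a t) * y - b t * x) ^ 2) with (y ^ 2).
  - field; lra.
  - rewrite E at 1; field; lra.
Qed.

(** This expresses infinite total mass: for [A < 0] the integral [c * (B - A)] exceeds [c * B],
    hence [M] once [B > M / c]. *)
Lemma filterlim_RInt_const_line (g : R -> R) (c : R) :
  0 < c -> (forall x, g x = c) ->
  filterlim (fun I : R * R => RInt g (fst I) (snd I))
    (filter_prod (Rbar_locally m_infty) (Rbar_locally p_infty))
    (Rbar_locally p_infty).
Proof.
  intros Hc Hg P [M HM].
  apply Filter_prod with (fun A => A < 0) (fun B => Rmax 0 (M / c) < B).
  - now exists 0.
  - now exists (Rmax 0 (M / c)).
  - intros A B HA HB; apply HM; simpl.
    rewrite (RInt_ext _ (fun _ => c)) by (intros; apply Hg).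
    rewrite RInt_const; unfold scal; simpl; unfold mult; simpl.
    assert (HB' : M / c < B) by (eapply Rle_lt_trans; [apply Rmax_r|exact HB]).
    apply (Rmult_lt_compat_r c) in HB'; [|exact Hc].
    replace (M / c * c) with M in HB' by (field; lra).
    assert (0 < - A * c) by (apply Rmult_lt_0_compat; lra).
    lra.
Qed.

(** * The kinetic equation reduced to the ODE systems *)

(** With [z = v - b x], the terms in [phi] match by the equation for [m]. In the terms in [phi'],
    writing [v = z + b x], the mixed part [z * x] cancels because [b' = - b^2], and the part [z^2]
    matches by the equation for [a]. *)
Lemma solves_granular_ansatz (lambda : R) (phi m a b : R -> R) (S : Rbar) :
  smooth phi -> is_RInt_line (fun y => phi (y ^ 2)) 1 ->
  (forall t, in_time S t -> 0 < m t /\ 0 < a t) ->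
  (forall t x, in_time S t -> ex_momentum (ansatz phi m a b) t x) ->
  ode_mab lambda S m a b -> solves_granular lambda S (ansatz phi m a b).
Proof.
  intros Hsm Hphi Hpos Hex Hode t x Dt.
  destruct (Hpos t Dt) as [Hm Ha].
  assert (Hs : 0 < sqrt (a t)) by now apply sqrt_lt_R0.
  assert (E : a t = sqrt (a t) * sqrt (a t)) by (symmetry; apply sqrt_sqrt; lra).
  split; [eexists; now apply is_RInt_line_ansatz|].
  split; [now apply Hex|].
  rewrite bulk_velocity_ansatz, density_ansatz by auto.
  assert (Hd : forall s, ex_derive phi s) by exact (Hsm 1%nat).
  intros v.
  set (z := v - b t * x); set (p := phi (a t * z ^ 2)); set (p' := Derive phi (a t * z ^ 2)).
  set (dm := lambda * m t ^ 2 / (2 * sqrt (a t))).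
  set (da := 2 * a t * b t + lambda * m t * sqrt (a t)).
  (* The values of [ft], [fx] and [q] given by the chain and product rules; [b t ^ 2 * x] is the
     time derivative of [z]. *)
  exists (dm * p + m t * p' * (da * z ^ 2 + 2 * a t * z * (b t ^ 2 * x))),
    (- (2 * m t * p' * a t * z * b t)), (m t * p + 2 * m t * p' * a t * z ^ 2).
  split; [|split; [|split]].
  - destruct (Hode t Dt) as [H1 [H2 H3]].
    apply is_derive_on_iff_ext in H1 as [M [HM H1]]; [|exact Dt].
    apply is_derive_on_iff_ext in H2 as [A [HA H2]]; [|exact Dt].
    apply is_derive_on_iff_ext in H3 as [B [HB H3]]; [|exact Dt].
    apply is_derive_on_iff_ext; [exact Dt|].
    exists (fun s => M s * phi (A s * (v - B s * x) ^ 2)).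
    split; [intros y Dy; unfold ansatz; now rewrite HM, HA, HB|].
    auto_derive.
    + repeat split; try (eexists; eassumption); apply Hd.
    + rewrite (is_derive_unique (fun x : R => M x) _ _ H1), (is_derive_unique (fun x : R => A x) _ _ H2),
        (is_derive_unique (fun x : R => B x) _ _ H3), HM, HA, HB by exact Dt.
      change (Derive (fun x1 : R => phi x1)) with (Derive phi).
      change (v + - (b t * x)) with z; fold dm da; unfold p', p, pow; ring.
  - unfold ansatz; auto_derive; [repeat split; apply Hd|].
    change (Derive (fun x1 : R => phi x1)) with (Derive phi).
    change (v + - (b t * x)) with z; unfold p', pow; ring.
  - unfold ansatz; auto_derive; [repeat split; apply Hd|].
    change (Derive (fun x1 : R => phi x1)) with (Derive phi).
    change (v + - (b t * x)) with z; unfold p', p, pow; ring.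
  - unfold dm, da; rewrite E; unfold z.
    (* Rewriting with [E] also changed [a t] under the root; undoing this leaves a rational identity
       in [sqrt (a t)]. *)
    replace (sqrt (sqrt (a t) * sqrt (a t))) with (sqrt (a t)) by now rewrite <- E.
    field; lra.
Qed.

(** In [rho' / rho = m' / m - a' / (2 a)] the two inelastic terms [lambda * rho / 2] cancel, leaving
    [- b]. Conversely, [a] is recovered as [(m / rho) ^ 2]. *)
Lemma ode_mab_iff_ode_rmb (lambda : R) (m a b rho : R -> R) (S : Rbar) :
  (forall t, in_time S t -> 0 < m t /\ 0 < a t) ->
  (forall t, in_time S t -> rho t = m t / sqrt (a t)) ->
  (ode_mab lambda S m a b <-> ode_rmb lambda S rho m b).
Proof.
  intros Hpos Hrho; split; intros Hode t Dt;
    destruct (Hpos t Dt) as [Hm Ha];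
    assert (Hs : 0 < sqrt (a t)) by (now apply sqrt_lt_R0);
    assert (E : a t = sqrt (a t) * sqrt (a t)) by (symmetry; apply sqrt_sqrt; lra);
    assert (Er := Hrho t Dt);
    destruct (Hode t Dt) as [H1 [H2 H3]];
    (split; [|split]); try exact H3.
  - apply is_derive_on_iff_ext in H1 as [M [HM H1]]; [|exact Dt].
    apply is_derive_on_iff_ext in H2 as [A [HA H2]]; [|exact Dt].
    apply is_derive_on_iff_ext; [exact Dt|].
    exists (fun s => M s / sqrt (A s)).
    split; [intros y Dy; now rewrite Hrho, HM, HA|].
    assert (EA := HA t Dt).
    auto_derive.
    + rewrite EA; repeat split; try (eexists; eassumption); lra.
    + rewrite (is_derive_unique (fun x : R => M x) _ _ H1), (is_derive_unique (fun x : R => A x) _ _ H2),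
        HM, EA, Er by exact Dt.
      rewrite E.
      replace (sqrt (sqrt (a t) * sqrt (a t))) with (sqrt (a t)) by now rewrite <- E.
      field; lra.
  - replace (lambda / 2 * rho t * m t) with (lambda * m t ^ 2 / (2 * sqrt (a t)));
      [exact H1|rewrite Er; field; lra].
  - replace (lambda * m t ^ 2 / (2 * sqrt (a t))) with (lambda / 2 * rho t * m t);
      [exact H2|rewrite Er; field; lra].
  - apply is_derive_on_iff_ext in H1 as [P [HP H1]]; [|exact Dt].
    apply is_derive_on_iff_ext in H2 as [M [HM H2]]; [|exact Dt].
    apply is_derive_on_iff_ext; [exact Dt|].
    assert (Hr : 0 < rho t) by (rewrite Er; now apply Rdiv_lt_0_compat).
    exists (fun s => (M s / P s) ^ 2).
    split.
    { intros y Dy; destruct (Hpos y Dy) as [Hmy Hay].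
      assert (0 < sqrt (a y)) by now apply sqrt_lt_R0.
      rewrite HM, HP, Hrho by exact Dy.
      rewrite <- (sqrt_sqrt (a y)) at 2 by lra; field; lra. }
    assert (EP := HP t Dt).
    auto_derive.
    + rewrite EP; repeat split; try (eexists; eassumption); lra.
    + rewrite (is_derive_unique (fun x : R => M x) _ _ H2), (is_derive_unique (fun x : R => P x) _ _ H1),
        HM, EP by exact Dt.
      rewrite Er.
      rewrite E.
      replace (sqrt (sqrt (a t) * sqrt (a t))) with (sqrt (a t)) by now rewrite <- E.
      field; lra.
Qed.

(** * Existence, explicit form and lifespan of the ODE solution *)

Lemma ode_rmb_blowup_solution (lambda T rho0 m0 : R) :
  0 < T ->
  ode_rmb lambda T (fun t => rho0 * T / (T - t))
    (fun t => m0 * Rpower (T / (T - t)) (lambda / 2 * rho0 * T))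
    (fun t => - (1 / (T - t))).
Proof.
  intros HT t Dt; destruct (Dt) as [H0 Ht]; simpl in Ht.
  assert (0 < T / (T - t)) by (apply Rdiv_lt_0_compat; lra).
  split; [|split]; apply is_derive_on_of_is_derive; try exact Dt; unfold Rpower; auto_derive;
    try (repeat split; lra).
  - field; lra.
  - split; [lra|split; [|exact I]].
    exact H.
  - change (T + - t) with (T - t); change (T * / (T - t)) with (T / (T - t)).
    field; lra.
  - field; lra.
Qed.

(** The identity is kept free of division by [T - t], so that it holds before anything is known
    about [t < T] and can be tested at [t = T] to bound the lifespan. *)
Lemma ode_rmb_solution_b (lambda T : R) (S : Rbar) (rho m b : R -> R) :
  0 < T -> b 0 = - (1 / T) -> ode_rmb lambda S rho m b ->
  forall t, in_time S t -> b t * (T - t) = - 1.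
Proof.
  intros HT Hb0 Hode t Dt.
  enough (1 + b t * (T - t) = 0) by lra.
  revert t Dt.
  intros t; apply (linear_ode_zero S (fun t => 1 + b t * (T - t)) (fun t => - b t)
    (fun t => b t ^ 2)).
  - intros s Ds; destruct (Hode s Ds) as [_ [_ H3]].
    apply is_derive_on_iff_ext in H3 as [B [HB H3]]; [|exact Ds].
    apply is_derive_on_iff_ext; [exact Ds|].
    exists (fun s => - B s); split; [intros y Dy; now rewrite HB|].
    auto_derive; [eexists; exact H3|].
    rewrite (is_derive_unique (fun x : R => B x) _ _ H3); ring.
  - intros s Ds; destruct (Hode s Ds) as [_ [_ H3]].
    apply is_derive_on_iff_ext in H3 as [B [HB H3]]; [|exact Ds].
    apply is_derive_on_iff_ext; [exact Ds|].
    exists (fun s => 1 + B s * (T - s)); split; [intros y Dy; now rewrite HB|].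
    auto_derive; [eexists; exact H3|].
    rewrite (is_derive_unique (fun x : R => B x) _ _ H3), HB by exact Ds; ring.
  - rewrite Hb0; field; lra.
Qed.

Lemma ode_rmb_lifespan (lambda T : R) (S : Rbar) (rho m b : R -> R) :
  0 < T -> b 0 = - (1 / T) -> ode_rmb lambda S rho m b -> Rbar_le S T.
Proof.
  intros HT Hb0 Hode.
  destruct (Rbar_le_lt_dec S T) as [|HS]; [assumption|exfalso].
  assert (E := ode_rmb_solution_b lambda T S rho m b HT Hb0 Hode T
    (conj (Rlt_le _ _ HT) HS)).
  lra.
Qed.

(** Both [rho * (T - t)] and [m * (T - t) ^ (lambda / 2 * rho0 * T)] are
    conserved. *)
Lemma ode_rmb_solution (lambda T rho0 m0 : R) (S : Rbar) (rho m b : R -> R) :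
  0 < T -> ode_rmb lambda S rho m b ->
  rho 0 = rho0 -> m 0 = m0 -> b 0 = - (1 / T) ->
  forall t, in_time S t ->
    b t = - (1 / (T - t)) /\
    rho t = rho0 * T / (T - t) /\
    m t = m0 * Rpower (T / (T - t)) (lambda / 2 * rho0 * T).
Proof.
  intros HT Hode Hr0 Hm0 Hb0.
  assert (HS := ode_rmb_lifespan lambda T S rho m b HT Hb0 Hode).
  assert (Hlt : forall t, in_time S t -> t < T).
  { intros t [_ Ht]; exact (Rbar_lt_le_trans t S T Ht HS). }
  assert (Hb : forall t, in_time S t -> b t = - (1 / (T - t))).
  { intros t Dt; assert (E := ode_rmb_solution_b lambda T S rho m b HT Hb0 Hode t Dt).
    specialize (Hlt t Dt).
    replace (b t) with (b t * (T - t) / (T - t)) by (field; lra).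
    rewrite E; field; lra. }
  assert (Hr : forall t, in_time S t -> rho t = rho0 * T / (T - t)).
  { intros t Dt.
    assert (E : rho t * (T - t) = rho 0 * (T - 0)).
    { apply (is_derive_on_0_const S (fun t => rho t * (T - t))); [|exact Dt].
      intros s Ds; destruct (Hode s Ds) as [H1 _]; specialize (Hlt s Ds).
      apply is_derive_on_iff_ext in H1 as [P [HP H1]]; [|exact Ds].
      apply is_derive_on_iff_ext; [exact Ds|].
      exists (fun s => P s * (T - s)); split; [intros y Dy; now rewrite HP|].
      auto_derive; [eexists; exact H1|].
      rewrite (is_derive_unique (fun x : R => P x) _ _ H1), HP, Hb by exact Ds; field; lra. }
    specialize (Hlt t Dt); rewrite Hr0 in E.
    replace (rho t) with (rho t * (T - t) / (T - t)) by (field; lra).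
    rewrite E; field; lra. }
  intros t Dt; split; [now apply Hb|split; [now apply Hr|]].
  set (p := lambda / 2 * rho0 * T).
  assert (E : m t * Rpower (T - t) p = m 0 * Rpower (T - 0) p).
  { apply (is_derive_on_0_const S (fun t => m t * Rpower (T - t) p)); [|exact Dt].
    intros s Ds; destruct (Hode s Ds) as [_ [H2 _]]; specialize (Hlt s Ds).
    apply is_derive_on_iff_ext in H2 as [M [HM H2]]; [|exact Ds].
    apply is_derive_on_iff_ext; [exact Ds|].
    exists (fun s => M s * Rpower (T - s) p); split; [intros y Dy; now rewrite HM|].
    unfold Rpower; auto_derive; [split; [eexists; exact H2|lra]|].
    rewrite (is_derive_unique (fun x : R => M x) _ _ H2), HM, Hr by exact Ds.
    (* By the formula for [rho], [m' = m * p / (T - s)], which cancels against the derivative of the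
       power. *)
    unfold p; field; lra. }
  specialize (Hlt t Dt).
  rewrite Hm0, Rminus_0_r in E.
  assert (0 < T / (T - t)) by (apply Rdiv_lt_0_compat; lra).
  (* The second [T] is the base of the power on the right; factoring it lets [Rpower (T - t) p]
     cancel on both sides. *)
  replace T with (T / (T - t) * (T - t)) in E at 2 by (field; lra).
  rewrite <- Rpower_mult_distr, <- Rmult_assoc in E by lra.
  apply Rmult_eq_reg_r in E; [exact E|apply Rgt_not_eq, exp_pos].
Qed.

(** * Powers of [T - t] and asymptotics as [t -> T^-] *)

Lemma at_left_in_time (T : R) (P : R -> Prop) :
  0 < T -> (forall t, in_time T t -> P t) -> at_left T P.
Proof.
  intros HT HP.
  assert (H : locally T (fun t => 0 < t)) by now apply open_gt.
  revert H; apply (filter_imp (F := locally T)); intros t Ht HtT.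
  apply HP; split; [lra|exact HtT].
Qed.

Lemma Rpower_Rdiv (x y z : R) : 0 < x -> 0 < y -> Rpower (x / y) z = Rpower x z * Rpower y (- z).
Proof.
  intros Hx Hy; unfold Rdiv.
  rewrite <- Rpower_mult_distr by (try apply Rinv_0_lt_compat; assumption).
  f_equal; unfold Rpower; rewrite ln_Rinv by exact Hy; f_equal; ring.
Qed.

Lemma Rpower_opp_1 (x : R) : 0 < x -> Rpower x (-1) = / x.
Proof.
  intros Hx; replace (-1) with (Ropp 1) by ring; now rewrite Rpower_Ropp, Rpower_1.
Qed.

Lemma filterlim_at_left_Rpower_pos (T q : R) :
  0 < q -> filterlim (fun t => Rpower (T - t) q) (at_left T) (locally 0).
Proof.
  intros Hq P [eps HP].
  (* The radius solves [delta ^ q = eps]. *)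
  exists (mkposreal (Rpower eps (/ q)) (exp_pos _)); intros t Ht HtT.
  apply HP; change (Rabs (Rpower (T - t) q - 0) < eps).
  change (Rabs (t - T) < Rpower eps (/ q)) in Ht.
  rewrite Rabs_left in Ht by lra.
  rewrite Rminus_0_r, Rabs_pos_eq by apply Rlt_le, exp_pos.
  replace (pos eps) with (Rpower (Rpower eps (/ q)) q).
  - apply Rlt_Rpower_l; lra.
  - rewrite Rpower_mult, Rinv_l, Rpower_1; [reflexivity|apply cond_pos|lra].
Qed.

Lemma filterlim_at_left_Rpower_neg (T q : R) :
  q < 0 -> filterlim (fun t => Rpower (T - t) q) (at_left T) (Rbar_locally p_infty).
Proof.
  intros Hq.
  apply filterlim_ext with (fun t => / Rpower (T - t) (- q)).
  { intros t; now rewrite <- Rpower_Ropp, Ropp_involutive. }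
  (* The positive power tends to [0] from the right, since [Rpower] is an exponential and so
     positive. *)
  apply filterlim_comp with (at_right 0); [|exact filterlim_Rinv_0_right].
  intros P HP; assert (Hq' : 0 < - q) by lra.
  generalize (filterlim_at_left_Rpower_pos T (- q) Hq' (fun y => 0 < y -> P y) HP).
  apply (filter_imp (F := at_left T)); intros t Ht; apply Ht, exp_pos.
Qed.

Lemma sim_left_filterlim_0 (T : R) (g h : R -> R) :
  sim_left T g h -> filterlim h (at_left T) (locally 0) -> filterlim g (at_left T) (locally 0).
Proof.
  intros [K [HK Hg]] Hh.
  apply filterlim_ext_loc with (fun t => K * h t).
  - revert Hg; apply filter_imp; intros t Ht; now symmetry.
  - replace 0 with (K * 0) by ring.
    exact (filterlim_comp _ _ _ h (fun y => K * y) _ _ _ Hh (filterlim_scal_r K 0)).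
Qed.

Lemma sim_left_filterlim_p_infty (T : R) (g h : R -> R) :
  sim_left T g h -> filterlim h (at_left T) (Rbar_locally p_infty) ->
  filterlim g (at_left T) (Rbar_locally p_infty).
Proof.
  intros [K [HK Hg]] Hh P [M HM].
  assert (H : at_left T (fun t => M / K < h t)) by (apply Hh; now exists (M / K)).
  generalize (filter_and _ _ Hg H); unfold filtermap; apply filter_imp; intros t [-> Ht].
  apply HM; apply (Rmult_lt_compat_l K) in Ht; [|exact HK].
  now replace (K * (M / K)) with M in Ht by (field; lra).
Qed.

(** * Assembly of the kinetic and blow-up statements *)

Theorem mainTheorem1 (lambda : R) (phi : R -> R)
  (hlambda : 0 < lambda)
  (phi_smooth : smooth phi)
  (phi_ge0 : forall s, 0 <= s -> 0 <= phi s)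
  (phi_mass : is_RInt_line (fun y => phi (y ^ 2)) 1) :
  (forall (S : Rbar) (m a b : R -> R),
    (forall t, in_time S t -> 0 < m t /\ 0 < a t) ->
    let f := ansatz phi m a b in
    (forall t x, in_time S t ->
       ex_density f t x /\ density f t x = m t / sqrt (a t)) /\
    (forall t, in_time S t ->
       filterlim (fun I : R * R => RInt (fun x => density f t x) (fst I) (snd I))
         (filter_prod (Rbar_locally m_infty) (Rbar_locally p_infty))
         (Rbar_locally p_infty)) /\
    (forall t x, in_time S t -> ex_momentum f t x ->
       bulk_velocity f t x = b t * x /\
       velocity_width phi f t x (1 / sqrt (a t))) /\
    ((forall t x, in_time S t -> ex_momentum f t x) ->
       ode_mab lambda S m a b -> solves_granular lambda S f) /\
    (forall rho : R -> R,
       (forall t, in_time S t -> rho t = m t / sqrt (a t)) ->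
       (ode_mab lambda S m a b <-> ode_rmb lambda S rho m b)))
  /\
  (forall rho0 m0 b0 T : R,
    0 < rho0 -> 0 < m0 -> b0 < 0 -> T = 1 / (- b0) ->
    0 < T /\
    (exists rho m b : R -> R,
       ode_rmb lambda T rho m b /\ rho 0 = rho0 /\ m 0 = m0 /\ b 0 = b0) /\
    (forall (S : Rbar) (rho m b : R -> R),
       ode_rmb lambda S rho m b -> rho 0 = rho0 -> m 0 = m0 -> b 0 = b0 ->
       Rbar_le S T /\
       forall t, in_time S t ->
         b t = - (1 / (T - t)) /\
         rho t = rho0 * T / (T - t) /\
         m t = m0 * Rpower (T / (T - t)) (lambda / 2 * rho0 * T)) /\
    (forall rho m b a : R -> R,
       ode_rmb lambda T rho m b -> rho 0 = rho0 -> m 0 = m0 -> b 0 = b0 ->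
       (forall t, in_time T t -> 0 < a t /\ rho t = m t / sqrt (a t)) ->
       filterlim b (at_left T) (Rbar_locally m_infty) /\
       filterlim rho (at_left T) (Rbar_locally p_infty) /\
       filterlim m (at_left T) (Rbar_locally p_infty) /\
       (forall t, in_time T t ->
          1 / sqrt (a t) = rho t / m t /\
          rho t / m t
            = rho0 / m0 * Rpower (T / (T - t)) (1 - lambda / 2 * rho0 * T)) /\
       sim_left T b (fun t => - Rpower (T - t) (-1)) /\
       sim_left T rho (fun t => Rpower (T - t) (-1)) /\
       sim_left T m (fun t => Rpower (T - t) (- (lambda / 2 * rho0 * T))) /\
       sim_left T (fun t => 1 / sqrt (a t))
         (fun t => Rpower (T - t) (lambda / 2 * rho0 * T - 1)) /\
       (lambda * rho0 * T > 2 ->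
          filterlim (fun t => 1 / sqrt (a t)) (at_left T) (locally 0)) /\
       (lambda * rho0 * T < 2 ->
          filterlim (fun t => 1 / sqrt (a t)) (at_left T)
            (Rbar_locally p_infty)))).
Proof.
  split.
  - intros S m a b Hpos f.
    split; [|split; [|split; [|split]]].
    + intros t x Dt; destruct (Hpos t Dt) as [Hm Ha]; split.
      * eexists; now apply is_RInt_line_ansatz.
      * now apply density_ansatz.
    + intros t Dt; destruct (Hpos t Dt) as [Hm Ha].
      apply filterlim_RInt_const_line with (m t / sqrt (a t)).
      * apply Rdiv_lt_0_compat; [exact Hm|now apply sqrt_lt_R0].
      * intros x; now apply density_ansatz.
    + intros t x Dt Hex; destruct (Hpos t Dt) as [Hm Ha].
      split; [now apply bulk_velocity_ansatz|now apply velocity_width_ansatz].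
    + now apply solves_granular_ansatz.
    + intros rho Hrho; now apply ode_mab_iff_ode_rmb.
  - intros rho0 m0 b0 T Hr0 Hm0 Hb0 ET.
    assert (HT : 0 < T) by (rewrite ET; apply Rdiv_lt_0_compat; lra).
    assert (Eb0 : b0 = - (1 / T)) by (rewrite ET; field; lra).
    set (p := lambda / 2 * rho0 * T).
    assert (Hp : 0 < p).
    { apply Rmult_lt_0_compat; [|exact HT]; apply Rmult_lt_0_compat; lra. }
    split; [exact HT|split; [|split]].
    + exists (fun t => rho0 * T / (T - t)), (fun t => m0 * Rpower (T / (T - t)) p),
        (fun t => - (1 / (T - t))).
      split; [now apply ode_rmb_blowup_solution|].
      rewrite Rminus_0_r, Eb0; split; [field; lra|split; [|reflexivity]].
      replace (T / T) with 1 by (field; lra).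
      unfold Rpower; rewrite ln_1, Rmult_0_r, exp_0; ring.
    + intros S rho m b Hode Hr Hm Hb; rewrite Eb0 in Hb; split.
      * now apply ode_rmb_lifespan with lambda rho m b.
      * now apply ode_rmb_solution.
    + intros rho m b a Hode Hr Hm Hb Ha; rewrite Eb0 in Hb.
      assert (Hsol := ode_rmb_solution lambda T rho0 m0 T rho m b HT Hode Hr Hm Hb).
      assert (Hw : forall t, in_time T t ->
        1 / sqrt (a t) = rho t / m t /\
        rho t / m t = rho0 / m0 * Rpower (T / (T - t)) (1 - p)).
      { intros t Dt; destruct (Hsol t Dt) as [_ [Ert Emt]]; destruct (Ha t Dt) as [Hat Era].
        assert (Htt : 0 < T / (T - t)).
        { destruct Dt as [_ Dt]; simpl in Dt; apply Rdiv_lt_0_compat; lra. }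
        assert (0 < sqrt (a t)) by now apply sqrt_lt_R0.
        assert (Hpw : 0 < Rpower (T / (T - t)) p) by apply exp_pos.
        split.
        - assert (0 < m t) by (rewrite Emt; now apply Rmult_lt_0_compat).
          rewrite Era; field; lra.
        - rewrite Ert, Emt; fold p; replace (1 - p) with (1 + - p) by ring.
          rewrite Rpower_plus, Rpower_1, Rpower_Ropp by exact Htt.
          destruct Dt as [_ Dt]; simpl in Dt; field; repeat split; lra. }
      (* Stated for [- b], which is positive, so that the criterion for divergence to [p_infty]
         applies; the sign is restored at the end. *)
      assert (Sb : sim_left T (fun t => - b t) (fun t => Rpower (T - t) (-1))).
      { exists 1; split; [lra|]; apply at_left_in_time; [exact HT|]; intros t Dt.
        destruct (Hsol t Dt) as [-> _]; destruct Dt as [_ Dt]; simpl in Dt.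
        rewrite Rpower_opp_1 by lra; field; lra. }
      assert (Sr : sim_left T rho (fun t => Rpower (T - t) (-1))).
      { exists (rho0 * T); split; [now apply Rmult_lt_0_compat|].
        apply at_left_in_time; [exact HT|]; intros t Dt.
        destruct (Hsol t Dt) as [_ [-> _]]; destruct Dt as [_ Dt]; simpl in Dt.
        rewrite Rpower_opp_1 by lra; field; lra. }
      assert (Sm : sim_left T m (fun t => Rpower (T - t) (- p))).
      (* The constant collects [T ^ p] from [(T / (T - t)) ^ p = T ^ p * (T - t) ^ (- p)]; the width
         below is treated in the same way with exponent [1 - p]. *)
      { exists (m0 * Rpower T p); split; [apply Rmult_lt_0_compat; [exact Hm0|apply exp_pos]|].
        apply at_left_in_time; [exact HT|]; intros t Dt.
        destruct (Hsol t Dt) as [_ [_ ->]]; destruct Dt as [_ Dt]; simpl in Dt.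
        fold p; rewrite Rpower_Rdiv by lra; ring. }
      assert (Sw : sim_left T (fun t => 1 / sqrt (a t)) (fun t => Rpower (T - t) (p - 1))).
      { exists (rho0 / m0 * Rpower T (1 - p)); split.
        { apply Rmult_lt_0_compat; [now apply Rdiv_lt_0_compat|apply exp_pos]. }
        apply at_left_in_time; [exact HT|]; intros t Dt.
        destruct (Hw t Dt) as [-> ->]; destruct Dt as [_ Dt]; simpl in Dt.
        rewrite Rpower_Rdiv, Ropp_minus_distr by lra; ring. }
      repeat match goal with |- _ /\ _ => split end; try assumption.
      * apply filterlim_ext with (fun t => - - b t); [intros t; apply Ropp_involutive|].
        apply filterlim_comp with (Rbar_locally p_infty); [|exact (filterlim_Rbar_opp p_infty)].
        apply sim_left_filterlim_p_infty with (1 := Sb).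
        apply filterlim_at_left_Rpower_neg; lra.
      * apply sim_left_filterlim_p_infty with (1 := Sr).
        apply filterlim_at_left_Rpower_neg; lra.
      * apply sim_left_filterlim_p_infty with (1 := Sm).
        apply filterlim_at_left_Rpower_neg; lra.
      * destruct Sb as [K [HK Sb]]; exists K; split; [exact HK|].
        revert Sb; apply filter_imp; intros t Ht; lra.
      (* Since [p = lambda * rho0 * T / 2], the threshold [2] is where the exponent [p - 1] changes
         sign. *)
      * intros H; apply sim_left_filterlim_0 with (1 := Sw).
        apply filterlim_at_left_Rpower_pos; unfold p; lra.
      * intros H; apply sim_left_filterlim_p_infty with (1 := Sw).
        apply filterlim_at_left_Rpower_neg; unfold p; lra.
Qed.
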